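(* With $\sigma_k$ the $k$-th elementary symmetric polynomial of $a_0,a_1,a_2,a_3$, let $$\mathfrak{f}_t^{c}=\tfrac19\Big(9\sigma_1^4-6(t+7)\sigma_1^2\sigma_2+(t+7)^2\sigma_2^2+12(t-1)\sigma_1\sigma_3-12(t-1)(3t+13)\sigma_4\Big).$$ If $t>5$, then $\mathfrak{f}_t^c\in\mathcal{E}(\mathcal{P}_{4,4}^{s0+})\cap\mathcal{E}(\mathcal{P}_{4,4}^+)$.
   Context: $\mathcal{P}_{4,4}^+$ is the cone of real quartic forms in $a_0,\dots,a_3$ that are nonnegative on $\mathbb{R}_+^4=[0,\infty)^4$. $\mathcal{P}_{4,4}^{s0+}$ is the subcone of those $f\in\mathcal{P}_{4,4}^+$ that are symmetric and satisfy $f(1,1,1,1)=0$. $\mathcal{E}(\mathcal{P})$ is the set of extremal elements of a cone $\mathcal{P}$: those $0\ne f\in\mathcal{P}$ such that $f=g+h$ with $g,h\in\mathcal{P}$ implies that $g$ and $h$ are scalar multiples of $f$. *)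

(* Defs.v *)
From HB Require Import structures.
From mathcomp Require Import all_boot all_order all_algebra.
From mathcomp Require Import classical_sets reals.
From mathcomp Require Import mpoly.

Set Implicit Arguments.
Unset Strict Implicit.
Unset Printing Implicit Defensive.

Import Order.TTheory GRing.Theory Num.Theory.

Local Open Scope classical_set_scope.
Local Open Scope ring_scope.

(* A real form is a homogeneous element of {mpoly R[4]}; the zero polynomial is
   4-homogeneous, so it belongs to both cones below. *)
Definition P44plus (R : realType) : set {mpoly R[4]} :=
  [set f | f \is 4.-homog /\
           forall a : 'I_4 -> R, (forall i, 0 <= a i) -> 0 <= f.@[a]].

Definition P44s0plus (R : realType) : set {mpoly R[4]} :=
  [set f | [/\ P44plus f, f \is symmetric & f.@[fun=> 1] = 0]].

Definition extremal_elements (R : realType) (n : nat) (P : set {mpoly R[n]}) :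
    set {mpoly R[n]} :=
  [set f | [/\ f != 0, P f &
               forall g h, P g -> P h -> f = g + h ->
                 (exists c : R, g = c *: f) /\ (exists d : R, h = d *: f)]].

Definition fct (R : realType) (t : R) : {mpoly R[4]} :=
  let s k := mesym 4 R k in
  9^-1 *: (9 *: s 1%N ^+ 4
           - (6 * (t + 7)) *: (s 1%N ^+ 2 * s 2%N)
           + (t + 7) ^+ 2 *: s 2%N ^+ 2
           + (12 * (t - 1)) *: (s 1%N * s 3%N)
           - (12 * (t - 1) * (3 * t + 13)) *: s 4%N).

(* Main.v *)
Require Import Defs.
From mathcomp Require Import all_boot all_order all_algebra.
From mathcomp Require Import classical_sets reals.
From mathcomp Require Import mpoly polyrcf zify ring lra.

(** Write f for the form and x0, ..., x3 for the variables.

    Nonnegativity.  By symmetry let d be the smallest coordinate and write the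
    other three as d + x, d + y, d + z.  In terms of d and of the elementary
    symmetric polynomials p, q, r of x, y, z >= 0, the form f is affine in r,
    and 0 <= r <= q^2 / (3 p).  It is therefore enough to look at the two ends
    of this range, where f is a quadratic polynomial in d that has nonnegative
    coefficients or a discriminant that is visibly nonpositive
    ([shifted_form_r0_ge0], [shifted_form_rmax_ge0]).

    Extremality.  On the orthant f vanishes at (1, 1, 1, 1), at the permutations
    of (t, 1, 1, 1), and, because t > 5, at the permutations of (s, 1, 0, 0) for
    the two distinct positive roots s of 3 s^2 - (t + 1) s + 3.  If f = g + h in
    the cone, then g vanishes at each of these points too, and, being
    nonnegative, it has zero derivative in every direction along which one can
    move both ways inside the orthant ([nonneg_zero_mderiv]).  The same holds
    for f, hence for q = g - c f, where c is the coefficient of x0^4 in g (that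
    of f is 1).  These linear conditions force q = 0 ([tangent_quartic_eq0]):

    - On the edge spanned by two coordinate axes, q restricts to a binary quartic
      with two double roots.  It is determined by its leading coefficient, so
      the vanishing of the coefficient of x0^4 spreads from edge to edge and
      kills all monomials in at most two variables.

    - Only x0 x1 x2 x3 and its twelve modifications x0 x1 x2 x3 * xp / xr
      remain.  For them the conditions at (1, 1, 1, 1) and at the permutations of
      (t, 1, 1, 1) are a small linear system without nonzero solution
      ([swap_coefs_eq0]).

    Since f is symmetric, extremality in the big cone implies extremality in the
    cone of symmetric forms. *)

Set Implicit Arguments.
Unset Strict Implicit.
Unset Printing Implicit Defensive.

Import Order.TTheory GRing.Theory Num.Theory.

Local Open Scope classical_set_scope.
Local Open Scope ring_scope.

(** * Nonnegativity on the orthant *)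

Lemma quadratic_ge0 (R : realFieldType) (A B C d : R) :
  0 < A -> B ^+ 2 <= A * C -> 0 <= A * d ^+ 2 + 2 * B * d + C.
Proof.
move=> A0 BAC; rewrite -(pmulr_rge0 _ A0).
have -> : A * (A * d ^+ 2 + 2 * B * d + C)
        = (A * d + B) ^+ 2 + (A * C - B ^+ 2) by ring.
by rewrite addr_ge0 ?sqr_ge0 ?subr_ge0.
Qed.

Section ShiftedForm.
Context (R : realFieldType).
Implicit Types u p q r d : R.

(** Nine times the form at (x + d, y + d, z + d, d), where p, q, r are the
    elementary symmetric polynomials of x, y, z and u = t - 1. *)
Definition shifted_form u p q r d : R :=
  3 * u ^+ 2 * (3 * p ^+ 2 - 8 * q) * d ^+ 2
  + 6 * u * d * (u * (p * q - 6 * r) - 3 * p ^+ 3 + 12 * p * q - 24 * r)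
  + (3 * p ^+ 2 - 8 * q - u * q) ^+ 2 + 12 * u * p * r.

(** Either the linear coefficient in d is nonnegative, and then all coefficients
    are, or it is negative, and its sign makes the discriminant nonpositive. *)
Lemma shifted_form_r0_ge0 u p q d :
    0 < u -> 0 < p -> 0 <= q -> 3 * q <= p ^+ 2 -> 0 <= d ->
  0 <= shifted_form u p q 0 d.
Proof.
move=> u0 p0 q0 qp d0.
have p20 : 0 < p ^+ 2 by rewrite exprn_gt0.
pose D := 3 * p ^+ 2 - 8 * q; pose b := (u + 12) * q - 3 * p ^+ 2.
have D0 : 0 < D by rewrite /D; lra.
pose A := 3 * u ^+ 2 * D; pose C := (D - u * q) ^+ 2.
have A0 : 0 < A by rewrite /A !mulr_gt0 ?exprn_gt0.
have -> : shifted_form u p q 0 d = A * d ^+ 2 + 2 * (3 * u * p * b) * d + C.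
  by rewrite /shifted_form /A /C /D /b; ring.
have [b0|b0] := lerP 0 b.
  by rewrite !addr_ge0 ?sqr_ge0 // !mulr_ge0 ?exprn_ge0 // ltW.
apply: quadratic_ge0 => //; rewrite -subr_ge0.
have -> : A * C - (3 * u * p * b) ^+ 2 =
   24 * (u * q) ^+ 2 * ((u + 6) * - b + (2 * u + 8) * q).
  by rewrite /A /C /D /b; ring.
by rewrite mulr_ge0 ?addr_ge0 ?mulr_ge0 ?sqr_ge0 //; lra.
Qed.

(** At this end of the range the discriminant in d is nonpositive whatever the
    sign of the linear coefficient. *)
Lemma shifted_form_rmax_ge0 u p q d :
    0 < u -> 0 < p -> 0 <= q -> 3 * q <= p ^+ 2 ->
  0 <= shifted_form u p q (q ^+ 2 / (3 * p)) d.
Proof.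
move=> u0 p0 q0 qp.
have p20 : 0 < p ^+ 2 by rewrite exprn_gt0.
have pn : p != 0 by rewrite gt_eqF.
pose D := 3 * p ^+ 2 - 8 * q.
pose b := (u + 12) * p * q - 3 * p ^+ 3 - (2 * u + 8) * (q ^+ 2 / p).
have D0 : 0 < D by rewrite /D; lra.
pose A := 3 * u ^+ 2 * D; pose C := (D - u * q) ^+ 2 + 4 * u * q ^+ 2.
have A0 : 0 < A by rewrite /A !mulr_gt0 ?exprn_gt0.
have -> : shifted_form u p q (q ^+ 2 / (3 * p)) d
        = A * d ^+ 2 + 2 * (3 * u * b) * d + C.
  by rewrite /shifted_form /A /C /D /b; field.
apply: quadratic_ge0 => //; rewrite -subr_ge0.
have -> : A * C - (3 * u * b) ^+ 2 =
   12 * u ^+ 2 * (u + 4) ^+ 2 * q ^+ 3 * (p ^+ 2 - 3 * q) / p ^+ 2.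
  by rewrite /A /C /D /b; field.
by rewrite !mulr_ge0 ?invr_ge0 ?exprn_ge0 ?subr_ge0 ?addr_ge0 // ltW.
Qed.

(** The form is affine in r, hence a convex combination of its values at the two
    ends of the range of r. *)
Lemma shifted_form_ge0 u p q r d :
    0 < u -> 0 < p -> 0 <= q -> 0 <= r -> 3 * q <= p ^+ 2 ->
    3 * p * r <= q ^+ 2 -> 0 <= d ->
  0 <= shifted_form u p q r d.
Proof.
move=> u0 p0 q0 r0 qp rq d0.
have r0f := shifted_form_r0_ge0 u0 p0 q0 qp d0.
have rmf := shifted_form_rmax_ge0 d u0 p0 q0 qp.
move: q0; rewrite le_eqVlt => /predU1P[q0|q0].
  have -> // : r = 0.
  have p30 : 0 < 3 * p by rewrite mulr_gt0.
  apply/le_anti; rewrite r0 andbT -(pmulr_rle0 r p30).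
  by rewrite (le_trans rq) // -q0 expr0n.
rewrite -(pmulr_rge0 _ (exprn_gt0 2 q0)).
have -> : q ^+ 2 * shifted_form u p q r d
  = 3 * p * r * shifted_form u p q (q ^+ 2 / (3 * p)) d
    + (q ^+ 2 - 3 * p * r) * shifted_form u p q 0 d.
  by rewrite /shifted_form; field; rewrite gt_eqF.
by rewrite addr_ge0 ?mulr_ge0 ?subr_ge0 ?(ltW p0).
Qed.
End ShiftedForm.

Section Nonnegativity.
Context (R : realFieldType) (t : R).
Implicit Types a b c d : R.

Definition fct_eval a b c d : R :=
  let s1 := a + b + c + d in
  let s2 := a * b + a * c + a * d + b * c + b * d + c * d in
  let s3 := a * b * c + a * b * d + a * c * d + b * c * d in
  9^-1 * ((3 * s1 ^+ 2 - (t + 7) * s2) ^+ 2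
          + 12 * (t - 1) * (s1 * s3 - (3 * t + 13) * (a * b * c * d))).

Lemma fct_eval_min_ge0 a b c d :
  1 < t -> 0 <= d -> d <= a -> d <= b -> d <= c -> 0 <= fct_eval a b c d.
Proof.
move=> t1 d0; rewrite -!(subr_ge0 d).
set x := a - d; set y := b - d; set z := c - d => x0 y0 z0.
have -> : fct_eval a b c d = 9^-1 * shifted_form (t - 1) (x + y + z)
    (x * y + x * z + y * z) (x * y * z) d.
  by rewrite /fct_eval /shifted_form /x /y /z; field.
have := addr_ge0 (addr_ge0 x0 y0) z0; rewrite le_eqVlt => /predU1P[p0|p0].
  have [-> -> ->] : [/\ x = 0, y = 0 & z = 0] by split; lra.
  by rewrite /shifted_form; nra.
apply: mulr_ge0; first by rewrite invr_ge0.
have sq (v w : R) := sqr_ge0 (v - w).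
apply: shifted_form_ge0; rewrite ?addr_ge0 ?mulr_ge0 ?subr_gt0 //.
  by have := (sq x y, sq x z, sq y z); case=> [[]]; lra.
have := (sq (x * y) (x * z), sq (x * y) (y * z), sq (x * z) (y * z)).
by case=> [[]]; lra.
Qed.

Lemma fct_eval_ge0 a b c d :
    1 < t -> 0 <= a -> 0 <= b -> 0 <= c -> 0 <= d ->
  0 <= fct_eval a b c d.
Proof.
move=> t1 a0 b0 c0 d0.
wlog ab : a b a0 b0 / a <= b => [wl|].
  have [|/ltW ba] := lerP a b; first exact: wl.
  by have := wl b a b0 a0 ba; congr (0 <= _); rewrite /fct_eval; ring.
wlog cd : c d c0 d0 / c <= d => [wl|].
  have [|/ltW dc] := lerP c d; first exact: wl.
  by have := wl d c d0 c0 dc; congr (0 <= _); rewrite /fct_eval; ring.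
wlog ac : a b c d a0 b0 c0 d0 ab cd / a <= c => [wl|].
  have [|/ltW ca] := lerP a c; first exact: wl.
  have := wl c d a b c0 d0 a0 b0 cd ab ca.
  by congr (0 <= _); rewrite /fct_eval; ring.
have -> : fct_eval a b c d = fct_eval b c d a by rewrite /fct_eval; ring.
by apply: fct_eval_min_ge0 => //; apply: le_trans cd.
Qed.
End Nonnegativity.

(** * The form as an element of the cones *)

Lemma meval_mwiden (R : comNzRingType) (n : nat) (a : 'I_n.+1 -> R)
    (p : {mpoly R[n]}) :
  (mwiden p).@[a] = p.@[fun i => a (widen_ord (leqnSn n) i)].
Proof.
rewrite [RHS]mevalE [LHS]raddf_sum; apply: eq_bigr => m _ /=.
rewrite mevalM mevalC /mmap1 rmorph_prod; congr (_ * _).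
by apply: eq_bigr => i _; rewrite rmorphXn /= mevalXU.
Qed.

Lemma meval_mesymS (R : comNzRingType) (n k : nat) (a : 'I_n.+1 -> R) :
  (mesym n.+1 R k.+1).@[a] =
    (mesym n R k.+1).@[fun i => a (widen_ord (leqnSn n) i)]
    + (mesym n R k).@[fun i => a (widen_ord (leqnSn n) i)] * a ord_max.
Proof. by rewrite mesymSS mevalD mevalM mevalXU !meval_mwiden. Qed.

Section Fct.
Context (R : realType) (t : R).

Lemma fctE (a : 'I_4 -> R) : (fct t).@[a] = fct_eval t (a 0) (a 1) (a 2) (a 3).
Proof.
rewrite /fct !(mevalZ, mevalD, mevalN, mevalM, rmorphXn) /=.
rewrite !meval_mesymS !mesym0E !meval1 !(@mesym_geqnE 0) // !meval0.
have -> : a ord_max = a 3 by congr a; apply/val_inj.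
set b0 := a _; set b1 := a _; set b2 := a _.
have -> : b0 = a 0 by congr a; apply/val_inj.
have -> : b1 = a 1 by congr a; apply/val_inj.
have -> : b2 = a 2 by congr a; apply/val_inj.
by rewrite /fct_eval; ring.
Qed.

Lemma fct_homog : fct t \is 4.-homog.
Proof.
have hs k : mesym 4 R k \is k.-homog by apply: dhomog_mesym.
have hM k l p q : p \is k.-homog -> q \is l.-homog -> (k + l = 4)%N ->
  p * q \is 4.-homog for [measure of mdeg].
  by move=> hp hq <-; apply: dhomogM.
rewrite /fct rpredZ // !(rpredB, rpredD) // rpredZ //.
- exact: (dhomogMn 4 (hs 1%N)).
- exact: hM (dhomogMn 2 (hs 1%N)) (hs 2%N) _.
- exact: (dhomogMn 2 (hs 2%N)).
- exact: hM (hs 1%N) (hs 3%N) _.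
- exact: (hs 4%N).
Qed.

Lemma fct_sym : fct t \is symmetric.
Proof.
rewrite /fct rpredZ // !(rpredB, rpredD, rpredZ, rpredM, rpredX) //;
by rewrite ?mesym_sym.
Qed.

Lemma fct_P44plus : 1 < t -> P44plus (fct t).
Proof.
move=> t1; split=> [|a a0]; first exact: fct_homog.
by rewrite fctE fct_eval_ge0.
Qed.

Lemma fct_vertex : (fct t).@[fun l => (l == 0)%:R] = 1.
Proof. by rewrite fctE /fct_eval -!val_eqE /=; field. Qed.

End Fct.

(** * First-order conditions at the zeros of a nonnegative polynomial *)

(** After division by 'X - c the quotient changes sign at c, unless it vanishes
    there. *)
Lemma poly_nonneg_root_deriv (R : rcfType) (p : {poly R}) (c : R) :
  0 < c -> (forall x, 0 <= x -> 0 <= p.[x]) -> p.[c] = 0 -> p^`().[c] = 0.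
Proof.
move=> c0 p_ge0 /eqP; rewrite -/(root p c) => /factor_theorem[q pE].
have -> : p^`().[c] = q.[c].
  by rewrite pE derivM derivXsubC !hornerE; ring.
apply/eqP/contraT => qc.
have [d d0 qd] := poly_cont c q (e := `|q.[c]|) ltac:(by rewrite normr_gt0).
pose e := Num.min (d / 2) (c / 2).
have e0 : 0 < e by rewrite lt_min !divr_gt0.
have [ed ec] : e < d /\ e < c.
  by rewrite !gt_min; split; apply/orP; [left|right]; lra.
have pq x : p.[x] = q.[x] * (x - c) by rewrite pE !hornerE.
case: (ltrgtP q.[c] 0) qc => // q0 _.
  have := p_ge0 (c + e) ltac:(lra).
  have := qd (c + e); rewrite pq addrAC subrr add0r (gtr0_norm e0) => /(_ ed).
  rewrite (ltr0_norm q0) ltr_norml => /andP[_ qe].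
  by rewrite pmulr_lge0 //; lra.
have := p_ge0 (c - e) ltac:(lra).
have := qd (c - e); rewrite pq addrAC subrr add0r normrN (gtr0_norm e0).
move=> /(_ ed); rewrite (gtr0_norm q0) ltr_norml => /andP[qe _].
by rewrite nmulr_lge0; lra.
Qed.

Section Slice.
Context (R : comNzRingType) (n : nat) (a : 'I_n -> R) (i : 'I_n).

(** The restriction of p to the line through a parallel to the i-th axis, as a
    polynomial in the i-th coordinate. *)
Definition slice (p : {mpoly R[n]}) : {poly R} :=
  mmap polyC (fun j => if j == i then 'X else (a j)%:P) p.

Lemma horner_slice (p : {mpoly R[n]}) (x : R) :
  (slice p).[x] = p.@[fun j => if j == i then x else a j].
Proof.
rewrite [RHS]mevalE horner_sum; apply: eq_bigr => m _.
rewrite hornerCM /mmap1 horner_prod; congr (_ * _); apply: eq_bigr => j _.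
by rewrite horner_exp; case: ifP; rewrite hornerE.
Qed.

Lemma deriv_slice (p : {mpoly R[n]}) : (slice p)^`() = slice p^`M(i).
Proof.
rewrite {2}(mpolyE p) (raddf_sum (mderiv i)) /slice (raddf_sum (mmap _ _)).
rewrite {1}/mmap raddf_sum; apply: eq_bigr => m _ /=.
rewrite mul_polyC derivZ mderivZ mderivX /slice !mmapZ !mmapX !mul_polyC.
congr (_ *: _); rewrite /mmap1 (bigD1 i) //= [in RHS](bigD1 i) //= eqxx.
rewrite mnmBE mnm1E eqxx subn1.
(* The other factors do not involve 'X. *)
set u := \prod_(_ < _ | _) _; set v := \prod_(_ < _ | _) _.
have -> : v = u.
  by apply: eq_bigr => j ji; rewrite mnmBE mnm1E [i == j]eq_sym (negPf ji) subn0.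
have [c ->] : exists c, u = c%:P.
  exists (\prod_(j < n | j != i) a j ^+ m j); rewrite rmorph_prod.
  by apply: eq_bigr => j /negPf ->; rewrite rmorphXn.
by rewrite derivM derivC mulr0 addr0 derivXn -scaler_nat scalerAl.
Qed.
End Slice.

Lemma nonneg_zero_mderiv (R : rcfType) (n : nat) (g : {mpoly R[n]})
    (a : 'I_n -> R) (i : 'I_n) :
    (forall b, (forall j, 0 <= b j) -> 0 <= g.@[b]) ->
    (forall j, 0 <= a j) -> g.@[a] = 0 -> 0 < a i ->
  g^`M(i).@[a] = 0.
Proof.
move=> g_ge0 a0 ga ai.
have self : (fun j => if j == i then a i else a j) =1 a.
  by move=> j; case: eqP => // ->.
rewrite -(meval_eq _ self) -horner_slice -deriv_slice.
apply: poly_nonneg_root_deriv => // [x x0|].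
  by rewrite horner_slice; apply: g_ge0 => j; case: ifP.
by rewrite horner_slice (meval_eq _ self).
Qed.

(** * Monomials in at most two variables *)

Lemma double_root_dvdp (R : fieldType) (p : {poly R}) (c : R) :
  p.[c] = 0 -> p^`().[c] = 0 -> ('X - c%:P) ^+ 2 %| p.
Proof.
move=> /eqP; rewrite -/(root p c) => /factor_theorem[q ->].
rewrite derivM derivXsubC !hornerE subrr mulr0 add0r => /eqP.
by rewrite -/(root q c) => /factor_theorem[r ->]; rewrite -mulrA dvdp_mull.
Qed.

Lemma two_double_roots_eq0 (R : fieldType) (p : {poly R}) (c d : R) :
    (size p <= 4)%N -> c != d -> p.[c] = 0 -> p^`().[c] = 0 ->
    p.[d] = 0 -> p^`().[d] = 0 ->
  p = 0.
Proof.
move=> sp cd pc dpc pd dpd; apply/eqP/contraT => p0.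
have : ('X - c%:P) ^+ 2 * ('X - d%:P) ^+ 2 %| p.
  rewrite Gauss_dvdp ?double_root_dvdp //.
  rewrite coprimep_expl // coprimep_expr //.
  by rewrite coprimep_XsubC root_XsubC eq_sym.
move=> /(dvdp_leq p0).
rewrite size_Mmonic ?monic_neq0 ?monic_exp ?monicXsubC // !size_exp_XsubC.
by rewrite leqNgt ltnS sp.
Qed.

Section EdgeMonomials.
Context (n d : nat).
Implicit Types i j : 'I_n.

Definition edge_mnm i j (k : nat) : 'X_{1..n} :=
  (U_(i) *+ k + U_(j) *+ (d - k))%MM.

Lemma edge_mnm0 i j : edge_mnm i j 0 = (U_(j) *+ d)%MM.
Proof. by apply/mnmP => l; rewrite mnmDE !mulmnE muln0 subn0. Qed.

Lemma edge_mnm_full i j : edge_mnm i j d = (U_(i) *+ d)%MM.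
Proof. by apply/mnmP => l; rewrite mnmDE !mulmnE subnn muln0 addn0. Qed.

(** Along the line from the j-th unit vector in direction i, every monomial that
    involves a third variable vanishes, and homogeneity determines each other
    monomial by its exponent in direction i.  For k > d both sides are 0. *)
Lemma coef_slice_edge (R : comNzRingType) (p : {mpoly R[n]}) (k : nat) i j :
    p \is d.-homog -> i != j ->
  (slice (fun l => (l == j)%:R) i p)`_k = p@_(edge_mnm i j k).
Proof.
move=> /dhomogP ph ij.
rewrite [in RHS](mpolyE p) /slice /mmap coef_sum [RHS]raddf_sum /= !big_seq.
apply: eq_bigr => m /ph /= md.
rewrite coefCM mcoeffZ mcoeffX; congr (_ * _).
rewrite /mmap1 (bigD1 i) //= eqxx.
pose on_edge := [forall l, (l != i) ==> (l != j) ==> (m l == 0%N)].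
have -> : \prod_(l < n | l != i)
    (if l == i then 'X else ((l == j)%:R)%:P) ^+ m l
    = (on_edge : nat)%:R%:P :> {poly R}.
  have [/forallP m0|] := boolP on_edge.
    rewrite big1 // => l li; have := m0 l; rewrite li (negPf li) /=.
    by case: eqP => _ /=; rewrite ?expr1n // => /eqP ->; rewrite expr0.
  rewrite negb_forall => /existsP[l]; rewrite !negb_imply => /and3P[li lj ml].
  by rewrite (bigD1 l) //= (negPf li) (negPf lj) expr0n (negPf ml) mul0r.
rewrite coefMC coefXn -natrM mulnb; congr (_%:R); congr nat_of_bool.
apply/andP/eqP => [[/eqP km /forallP m0]|mE].
  have msum : (m i + m j = d)%N.
    rewrite -(md : mdeg m = d) mdegE (bigD1 i) //= (bigD1 j) 1?eq_sym //=.
    rewrite big1 ?addn0 // => l /andP[li lj].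
    by have := m0 l; rewrite li lj => /eqP.
  apply/mnmP => l; rewrite mnmDE !mulmnE !mnm1E.
  have := m0 l; rewrite ![l == _]eq_sym.
  case: eqP => [<-|_] /=; first by rewrite eq_sym (negPf ij); lia.
  by case: eqP => [<-|_] /= => [|/eqP ->]; lia.
rewrite mE mnmDE !mulmnE !mnm1E eqxx [j == i]eq_sym (negPf ij).
split; first by apply/eqP; lia.
apply/forallP => l; apply/implyP => li; apply/implyP => lj.
rewrite mE mnmDE !mulmnE !mnm1E ![_ == l]eq_sym (negPf li) (negPf lj).
by rewrite !mul0n.
Qed.
End EdgeMonomials.

Definition edge_point (R : nzRingType) (n : nat) (x : R) (i j : 'I_n) :
    'I_n -> R :=
  fun l => if l == i then x else (l == j)%:R.

(** The slice is a cubic because the coefficient of x_i^4 vanishes, but it has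
    two double roots. *)
Lemma edge_coefs_eq0 (R : fieldType) (n : nat) (q : {mpoly R[n]})
    (i j : 'I_n) (u v : R) :
    q \is 4.-homog -> i != j -> u != v ->
    (forall x, x \in [:: u; v] ->
      q.@[edge_point x i j] = 0 /\ q^`M(i).@[edge_point x i j] = 0) ->
    q@_(U_(i) *+ 4)%MM = 0 ->
  forall k, q@_(edge_mnm 4 i j k) = 0.
Proof.
move=> qh ij uv tangent qi k.
rewrite -(coef_slice_edge _ qh) //; set p := slice _ _ _.
have px x : p.[x] = q.@[edge_point x i j] by rewrite horner_slice.
have dpx x : p^`().[x] = q^`M(i).@[edge_point x i j].
  by rewrite deriv_slice horner_slice.
have [u0 du0] := tangent u (mem_head _ _).
have [v0 dv0] : q.@[edge_point v i j] = 0 /\ q^`M(i).@[edge_point v i j] = 0.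
  by apply: tangent; rewrite !inE eqxx orbT.
rewrite (@two_double_roots_eq0 R p u v) ?coef0 ?px ?dpx //.
apply/leq_sizeP => l; rewrite leq_eqVlt => /predU1P[<-|l4].
  by rewrite (coef_slice_edge _ qh) // edge_mnm_full.
rewrite (coef_slice_edge _ qh) //; apply: dhomog_nemf_coeff qh _ => /=.
by rewrite mdegD !mdegMn !mdeg1; apply/eqP; lia.
Qed.

(** * Monomials in at least three variables *)

(** The exponent of x0 x1 x2 x3 * xp / xr; all p = r give x0 x1 x2 x3. *)
Definition swap_mnm (p r : 'I_4) : 'X_{1..4} :=
  [multinom (1 + (i == p) - (i == r))%N | i < 4].

Lemma swap_mnm_of_nat (a b c d : nat) : (a + b + c + d = 4)%N ->
    (a + b != 4)%N -> (a + c != 4)%N -> (a + d != 4)%N ->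
    (b + c != 4)%N -> (b + d != 4)%N -> (c + d != 4)%N ->
  [:: a; b; c; d] \in
    [seq [seq (1 + (i == p) - (i == r))%N | i <- iota 0 4]
       | p <- iota 0 4, r <- iota 0 4].
Proof.
by case: a b c d =>
  [|[|[|[|[|a]]]]] [|[|[|[|[|b]]]]] [|[|[|[|[|c]]]]] [|[|[|[|[|d]]]]].
Qed.

Lemma off_edge_mnm (m : 'X_{1..4}) :
    mdeg m = 4 -> (forall i j, i != j -> (m i + m j != 4)%N) ->
  exists p r, m = swap_mnm p r.
Proof.
rewrite mdegE !big_ord_recr big_ord0 /= add0n => deg_m off.
have := swap_mnm_of_nat deg_m; rewrite !off //.
move=> /(_ isT isT isT isT isT isT)/allpairsP[[p r] []].
rewrite !mem_iota !add0n /= => p4 r4 [m0 m1 m2 m3].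
exists (Ordinal p4), (Ordinal r4); apply/mnmP => i; rewrite mnmE -!val_eqE /=.
by case: i => [[|[|[|[|//]]]] lti] /=;
  [move: m0|move: m1|move: m2|move: m3];
  congr (_ = _); congr (m _); apply/val_inj.
Qed.

Lemma swap_mnm_inj (p r p' r' : 'I_4) :
  p != r -> swap_mnm p r = swap_mnm p' r' -> p = p' /\ r = r'.
Proof.
move=> pr /mnmP sw; have := sw p; have := sw r.
rewrite !mnmE !eqxx [r == p]eq_sym (negPf pr).
by case: (p =P p') => [?|_]; case: (r =P r') => [?|_] //;
  do 2?[case: (_ == _)].
Qed.

Lemma swap_mnm_diag (p : 'I_4) : swap_mnm p p = swap_mnm 0 0.
Proof. by apply/mnmP => i; rewrite !mnmE !addnK. Qed.

(** The diagonal of the double sum is cleared so that x0 x1 x2 x3 is counted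
    once, in the separate term. *)
Lemma off_edge_expansion (R : comNzRingType) (q : {mpoly R[4]}) :
    q \is 4.-homog ->
    (forall i j k, i != j -> q@_(edge_mnm 4 i j k) = 0) ->
  q = \sum_p \sum_r
        (if p == r then 0 else q@_(swap_mnm p r)) *: 'X_[swap_mnm p r]
      + q@_(swap_mnm 0 0) *: 'X_[swap_mnm 0 0].
Proof.
move=> qh qe; apply/mpolyP => m.
have q_swap : q@_m != 0 -> exists p r, m = swap_mnm p r.
  move=> qm; have deg_m : mdeg m = 4.
    by apply/eqP; apply: contraNT qm => /(dhomog_nemf_coeff qh) ->.
  apply: off_edge_mnm => // i j ij; apply: contraNN qm => /eqP mij.
  suff -> : m = edge_mnm 4 i j (m i) by rewrite qe.
  move: deg_m; rewrite mdegE (bigD1 i) //= (bigD1 j) 1?eq_sym //= addnA mij.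
  move/eqP; rewrite -[X in _ == X]addn0 eqn_add2l sum_nat_eq0 => /forallP m0.
  apply/mnmP => l; rewrite mnmDE !mulmnE !mnm1E.
  have := m0 l; rewrite ![l == _]eq_sym.
  case: (i =P l) => [<-|_] /=.
    by rewrite [j == i]eq_sym (negPf ij); lia.
  by case: (j =P l) => [<-|_] /= => [|/eqP ->]; lia.
rewrite mcoeffD mcoeffZ mcoeffX raddf_sum /=.
under eq_bigr => p _.
  rewrite raddf_sum /=.
  under eq_bigr => r _ do rewrite mcoeffZ mcoeffX.
  over.
have [->|m00] := eqVneq m (swap_mnm 0 0).
  rewrite mulr1 big1 ?add0r // => p _; rewrite big1 // => r _.
  case: (eqVneq p r) => [_|pr]; first by rewrite mul0r.
  case: eqP => [/(swap_mnm_inj pr)[pE rE]|]; last by rewrite mulr0.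
  by rewrite pE rE eqxx in pr.
rewrite mulr0 addr0.
have [[p [r mE]]|no_swap] := boolp.pselect (exists p r, m = swap_mnm p r).
  have pr : p != r.
    by apply: contraNN m00 => /eqP pr; rewrite mE pr swap_mnm_diag.
  rewrite mE (bigD1 p) //= [X in _ + X]big1 => [|p' p'p]; last first.
    rewrite big1 // => r' _.
    case: (_ =P swap_mnm p r) => [/esym/(swap_mnm_inj pr)[pE _]|].
      by rewrite pE eqxx in p'p.
    by rewrite mulr0.
  rewrite addr0 (bigD1 r) //= big1 => [|r' r'r]; last first.
    case: (_ =P swap_mnm p r) => [/esym/(swap_mnm_inj pr)[_ rE]|].
      by rewrite rE eqxx in r'r.
    by rewrite mulr0.
  by rewrite (negPf pr) eqxx mulr1 addr0.
rewrite big1 => [|p _]; last first.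
  rewrite big1 // => r _; case: (_ =P m) => [/esym mE|]; last by rewrite mulr0.
  by case: no_swap; exists p, r.
by apply/eqP/contraT => /q_swap.
Qed.

(** * The linear system at the interior zeros *)

Definition raised_point (R : nzRingType) (x : R) (i : 'I_4) : 'I_4 -> R :=
  fun j => if j == i then x else 1.

Lemma sum_delta2 (R : comNzRingType) (n : nat) (f : 'I_n -> R) (i k : 'I_n)
    (u v w : R) :
  \sum_r f r * (u + (k == r)%:R * v + (i == r)%:R * w)
    = u * (\sum_r f r) + v * f k + w * f i.
Proof.
have delta j y : \sum_r f r * ((j == r)%:R * y) = y * f j.
  rewrite (bigD1 j) //= eqxx mul1r big1 ?addr0 1?mulrC // => r rj.
  by rewrite eq_sym (negPf rj) mul0r mulr0.
under eq_bigr => r _ do rewrite !mulrDr.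
by rewrite !big_split /= !delta -mulr_suml [_ * u]mulrC.
Qed.

Section SwapPolynomial.
Context (R : comNzRingType) (e : 'I_4 -> 'I_4 -> R) (d : R).
Implicit Types (i k : 'I_4) (x : R).

Definition swap_poly : {mpoly R[4]} :=
  \sum_p \sum_r e p r *: 'X_[swap_mnm p r] + d *: 'X_[swap_mnm 0 0].

Let A p := \sum_r e p r.
Let B r := \sum_p e p r.
Let T := \sum_p A p.

Lemma mderiv_swap_poly i k x :
  swap_poly^`M(k).@[raised_point x i] =
   \sum_p \sum_r
     e p r * ((swap_mnm p r k)%:R * x ^+ (swap_mnm p r i - (k == i)))
   + d * x ^+ (1 - (k == i)).
Proof.
have X m : ('X_[m - U_(k)]).@[raised_point x i] = x ^+ (m i - (k == i)).
  rewrite mevalX (bigD1 i) //= /raised_point eqxx mnmBE mnm1E.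
  by rewrite big1 ?mulr1 // => j /negPf ->; rewrite expr1n.
rewrite mderivD mevalD mderivZ mderivX !mevalZ X !mnmE !addnK mul1r.
congr (_ + _).
rewrite (raddf_sum (mderiv k)) raddf_sum; apply: eq_bigr => p _ /=.
rewrite (raddf_sum (mderiv k)) raddf_sum; apply: eq_bigr => r _ /=.
by rewrite mderivZ mderivX !mevalZ X.
Qed.

(** In both lemmas below, off the diagonal p = r, where the coefficients vanish,
    each summand is rewritten as an affine function of Kronecker symbols. *)
Lemma mderiv_swap_poly_same i x : (forall p, e p p = 0) ->
  swap_poly^`M(i).@[raised_point x i] = T + (2 * x - 1) * A i - B i + d.
Proof.
move=> e_diag; rewrite mderiv_swap_poly eqxx subnn mulr1; congr (_ + _).
transitivity (\sum_p (A p * (1 + (i == p)%:R * (2 * x - 1) + (i == p)%:R * 0)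
                      - e p i)).
{ apply: eq_bigr => p _.
  have -> : A p * (1 + (i == p)%:R * (2 * x - 1) + (i == p)%:R * 0) - e p i
     = \sum_r e p r * ((1 + (i == p)%:R * (2 * x - 1))
                       + (i == r)%:R * -1 + (i == r)%:R * 0).
    by rewrite sum_delta2 -/(A p); ring.
  apply: eq_bigr => r _.
  have [<-|pr] := eqVneq p r; first by rewrite e_diag !mul0r.
  congr (_ * _); rewrite mnmE.
  have [ip|_] := eqVneq i p; have [ir|_] := eqVneq i r; rewrite /=.
    by rewrite -ip -ir eqxx in pr.
  all: by rewrite /= ?(addn0, addn1, subn0, subn1) /= ?expr0 ?expr1; ring. }
by rewrite sumrB sum_delta2 -/T -/(B i); ring.
Qed.

Lemma mderiv_swap_poly_other i k x : (forall p, e p p = 0) -> k != i ->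
  swap_poly^`M(k).@[raised_point x i] =
    x * (T + A k - B k + d) + (x ^+ 2 - x) * (A i - e i k)
    - (x - 1) * (B i + e k i).
Proof.
move=> e_diag ki; rewrite mderiv_swap_poly (negPf ki) !subn0 expr1.
transitivity (\sum_p
   (A p * (x + (k == p)%:R * x + (i == p)%:R * (x ^+ 2 - x))
    - e p k * (x + (k == p)%:R * 0 + (i == p)%:R * (x ^+ 2 - x))
    - e p i * ((x - 1) + (k == p)%:R * (x - 1) + (i == p)%:R * 0)) + d * x).
{ congr (_ + _); apply: eq_bigr => p _.
  set u := x + _ + _; set v := x + _ + _; set w := x - 1 + _ + _.
  have -> : A p * u - e p k * v - e p i * w
          = \sum_r e p r * (u + (k == r)%:R * - v + (i == r)%:R * - w).
    by rewrite sum_delta2 -/(A p); ring.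
  apply: eq_bigr => r _.
  have [<-|pr] := eqVneq p r; first by rewrite e_diag !mul0r.
  congr (_ * _); rewrite !mnmE /u /v /w.
  have [ip|_] := eqVneq i p; have [ir|_] := eqVneq i r;
  have [kp|_] := eqVneq k p; have [kr|_] := eqVneq k r; rewrite /=.
  all: try by [rewrite -ip -ir eqxx in pr | rewrite -kp -kr eqxx in pr
     | rewrite kp -ip eqxx in ki | rewrite kr -ir eqxx in ki].
  all: by rewrite ?(addn0, addn1, subn0, subn1) /= ?expr0 ?expr1; ring. }
by rewrite !sumrB !sum_delta2 -/T -/(B i) -/(B k) !e_diag; ring.
Qed.
End SwapPolynomial.

(** The derivatives along the raised coordinate at x = 1 and x = t give the
    vanishing of all row sums, then of d and of all column sums.  What is left
    of the other derivatives at x = t is t e_ik + e_ki = 0 for all i, k. *)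
Lemma swap_coefs_eq0 (R : numFieldType) (e : 'I_4 -> 'I_4 -> R) (d t : R) :
    1 < t -> (forall p, e p p = 0) ->
    (forall i k x, x \in [:: 1; t] ->
      (swap_poly e d)^`M(k).@[raised_point x i] = 0) ->
  (forall p r, e p r = 0) /\ d = 0.
Proof.
move=> t1 e_diag tangent.
have x1 : 1 \in [:: 1; t] by rewrite inE eqxx.
have xt : t \in [:: 1; t] by rewrite !inE eqxx orbT.
have t10 : t - 1 != 0 by rewrite subr_eq0 gt_eqF.
pose A p := \sum_r e p r; pose B r := \sum_p e p r.
have A0 i : A i = 0.
  have := tangent i i t xt; have := tangent i i 1 x1.
  rewrite !mderiv_swap_poly_same // -/(A i) => E1 Et.
  apply: (mulfI t10); rewrite mulr0.
  apply: (mulfI (x := 2)); first by rewrite pnatr_eq0.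
  rewrite mulr0 -[RHS](subrr 0) -[X in _ = X - _]Et -[X in _ = _ - X]E1.
  by ring.
have T0 : \sum_p \sum_r e p r = 0 by apply: big1 => i _; apply: A0.
have B0 i : B i = d.
  have := tangent i i 1 x1.
  rewrite mderiv_swap_poly_same // -/(A i) -/(B i) T0 A0.
  by move=> /eqP; rewrite mulr0 !add0r addrC subr_eq0 => /eqP.
have d0 : d = 0.
  have : \sum_i B i = 0 by rewrite exchange_big.
  rewrite (eq_bigr (fun=> d)) // sumr_const card_ord => /eqP.
  by rewrite mulrn_eq0 => /eqP.
have te i k : k != i -> t * e i k = - e k i.
  move=> ki; have := tangent i k t xt.
  rewrite mderiv_swap_poly_other // -/(A i) -/(A k) -/(B i) -/(B k).
  rewrite T0 !A0 !B0 d0 => E.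
  by apply: (mulfI t10); rewrite -[LHS]addr0 -[X in _ + X]E; ring.
split=> // p r; have [->|rp] := eqVneq r p; first exact: e_diag.
have : (t ^+ 2 - 1) * e p r = 0.
  by rewrite mulrBl mul1r expr2 -mulrA te // mulrN te 1?eq_sym // opprK subrr.
move/eqP; rewrite mulf_eq0 => /orP[|/eqP //].
by rewrite subr_eq0 gt_eqF // expr_gt1 // (ltW (lt_trans _ t1)).
Qed.

(** * Extremality *)

Lemma tangent_quartic_eq0 (R : numFieldType) (q : {mpoly R[4]}) (t u v : R) :
    1 < t -> u != v -> q \is 4.-homog -> q.@[fun l => (l == 0)%:R] = 0 ->
    (forall i j x, i != j -> x \in [:: u; v] ->
      q.@[edge_point x i j] = 0 /\ q^`M(i).@[edge_point x i j] = 0) ->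
    (forall i k x, x \in [:: 1; t] -> q^`M(k).@[raised_point x i] = 0) ->
  q = 0.
Proof.
move=> t1 uv qh q_vertex edge inner.
have qi0 : q@_(U_(0%R) *+ 4)%MM = 0.
  rewrite -(edge_mnm0 4 1) -(coef_slice_edge _ qh) //.
  rewrite -horner_coef0 horner_slice -[RHS]q_vertex.
  by apply: meval_eq => l; case: eqP => // ->.
have qe i j k : i != j -> q@_(edge_mnm 4 i j k) = 0.
  move=> ij; apply: (edge_coefs_eq0 qh ij uv) => [x|]; first exact: edge.
  (* The edge from 0 to i carries the vanishing from x_0^4 to x_i^4. *)
  have [-> //|i0] := eqVneq i 0; rewrite -(edge_mnm0 4 0).
  have i0' : 0 != i by rewrite eq_sym.
  by apply: (edge_coefs_eq0 qh i0' uv) => // x; apply: edge.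
set e := fun p r => if p == r then 0 else q@_(swap_mnm p r).
have qE : q = swap_poly e q@_(swap_mnm 0 0) := off_edge_expansion qh qe.
have [e0 d0] : (forall p r, e p r = 0) /\ q@_(swap_mnm 0 0) = 0.
  apply: (swap_coefs_eq0 t1) => [p|i k x xt]; first by rewrite /e eqxx.
  by rewrite -qE; apply: inner.
rewrite qE d0 /swap_poly scale0r addr0.
by apply: big1 => p _; apply: big1 => r _; rewrite e0 scale0r.
Qed.

Section Zeros.
Context (R : realType) (t : R).

Lemma fct_raised_point (i : 'I_4) (x : R) :
  x \in [:: 1; t] -> (fct t).@[raised_point x i] = 0.
Proof.
move=> xt; have x0 : (x - 1) * (x - t) = 0.
  by move: xt; rewrite !inE => /orP[] /eqP ->; ring.
(* On (x, 1, 1, 1) the form is the square of (x - 1) * (x - t). *)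
have slice0 : 9^-1 * (9 * ((x - 1) * (x - t)) ^+ 2) = 0 by rewrite x0; ring.
rewrite fctE /raised_point -[RHS]slice0.
by case: i => [[|[|[|[|//]]]] ?]; rewrite -!val_eqE /= /fct_eval; ring.
Qed.

Lemma fct_edge_point (i j : 'I_4) (x : R) : i != j ->
  3 * x ^+ 2 - (t + 1) * x + 3 = 0 -> (fct t).@[edge_point x i j] = 0.
Proof.
move=> + x0.
have edge0 : 9^-1 * (3 * x ^+ 2 - (t + 1) * x + 3) ^+ 2 = 0.
  by rewrite x0; ring.
rewrite fctE /edge_point -[X in _ -> _ = X]edge0.
case: i => [[|[|[|[|//]]]] ?]; case: j => [[|[|[|[|//]]]] ?] //;
by rewrite -!val_eqE /= /fct_eval => _; ring.
Qed.

Lemma edge_roots : 5 < t -> exists u v : R,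
  [/\ u != v, 0 < u, 0 < v, 3 * u ^+ 2 - (t + 1) * u + 3 = 0
    & 3 * v ^+ 2 - (t + 1) * v + 3 = 0].
Proof.
move=> t5; have disc0 : 0 < (t + 1) ^+ 2 - 36 by nra.
set w := Num.sqrt ((t + 1) ^+ 2 - 36).
have w2 : w ^+ 2 = (t + 1) ^+ 2 - 36 by rewrite sqr_sqrtr // ltW.
have w0 : 0 < w by rewrite sqrtr_gt0.
have wt : w < t + 1.
  by rewrite -(ltr_pXn2r (n := 2)) ?nnegrE ?w2 //; lra.
by exists ((t + 1 + w) / 6), ((t + 1 - w) / 6); split; lra.
Qed.

Lemma fct_minorant (g h : {mpoly R[4]}) :
    5 < t -> P44plus g -> P44plus h -> fct t = g + h ->
  g = g.@[fun l => (l == 0)%:R] *: fct t.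
Proof.
move=> t5 [gh g_ge0] [_ h_ge0] fE.
have t1 : 1 < t by lra.
have [_ f_ge0] := fct_P44plus t1.
have g0 a : (forall l, 0 <= a l) -> (fct t).@[a] = 0 -> g.@[a] = 0.
  move=> a0; rewrite fE mevalD => /eqP.
  by rewrite paddr_eq0 ?g_ge0 ?h_ge0 // => /andP[/eqP].
have [u [v [uv u0 v0 eu ev]]] := edge_roots t5.
set c := g.@[_]; apply/eqP; rewrite -subr_eq0; apply/eqP.
have dq0 a i : (forall l, 0 <= a l) -> 0 < a i -> (fct t).@[a] = 0 ->
    (g - c *: fct t)^`M(i).@[a] = 0.
  move=> a0 ai fa; rewrite mderivB mderivZ mevalB mevalZ.
  rewrite !(@nonneg_zero_mderiv _ _ _ a) //; first by rewrite mulr0 subr0.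
  exact: g0.
apply: (@tangent_quartic_eq0 _ _ t u v) => //.
- by apply: rpredB => //; apply: rpredZ; apply: fct_homog.
- by rewrite mevalB mevalZ fct_vertex mulr1 subrr.
- move=> i j x ij xuv.
  have [x0 ex] : 0 < x /\ 3 * x ^+ 2 - (t + 1) * x + 3 = 0.
    by move: xuv; rewrite !inE => /orP[] /eqP ->.
  have a0 l : 0 <= edge_point x i j l.
    by rewrite /edge_point; case: ifP => _; rewrite ?ler0n ?ltW.
  have fa := fct_edge_point ij ex.
  split; first by rewrite mevalB mevalZ fa (g0 _ a0 fa) mulr0 subr0.
  by apply: dq0 => //; rewrite /edge_point eqxx.
- move=> i k x xt.
  have x0 : 0 < x by move: xt; rewrite !inE => /orP[] /eqP ->; lra.
  have a0 l : 0 < raised_point x i l by rewrite /raised_point; case: ifP.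
  by apply: dq0 => // [l|]; [rewrite ltW|apply: fct_raised_point].
Qed.
End Zeros.

Unset Implicit Arguments.

Theorem proposition1p6 (R : realType) (t : R) (ht : 5 < t) :
  (extremal_elements (@P44s0plus R) `&` extremal_elements (@P44plus R))
    (fct t).
Proof.
have t1 : 1 < t by lra.
have fP := fct_P44plus t1.
have f_neq0 : fct t != 0.
  by apply: contra_eq_neq (fct_vertex t) => ->; rewrite meval0 eq_sym oner_eq0.
have split_fct g h : P44plus g -> P44plus h -> fct t = g + h ->
    (exists c : R, g = c *: fct t) /\ (exists d : R, h = d *: fct t).
  move=> gP hP fE; split.
    by exists g.@[fun l => (l == 0)%:R]; apply: fct_minorant ht gP hP fE.
  exists h.@[fun l => (l == 0)%:R].
  by apply: (@fct_minorant _ _ _ g) => //; rewrite addrC.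
split; split=> //; last by move=> g h [gP _ _] [hP _ _]; apply: split_fct.
split=> //; first exact: fct_sym.
rewrite (@meval_eq _ _ _ (raised_point 1 0)).
  by apply: fct_raised_point; rewrite inE eqxx.
by move=> l; rewrite /raised_point if_same.
Qed.
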